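(* Let $(\mathbb{S},\to)$ be a topological timed transition system. The following properties hold: (1) $E_s$ is monotonic and preserves finite unions. (2) $R_s$ is monotonic, preserves finite unions, is a closure (i.e. $I\subseteq R_s(I)=R_s(R_s(I))$), and $\pi(E_s(I))\subseteq R_s(I)$. (3) For every $I\subseteq\mathbb{S}$: $E_f(I)\subseteq E_s(\overline{I})$ and $R_f(I)\subseteq R_s(\overline{I})$. (4) If $\mathcal{H}$ is a hybrid system on $\mathbb{S}$, then for every closed $I\subseteq\mathbb{S}$, $E_{s,\mathcal{H}}(I)=R_{s,t(\mathcal{H})}(\{0\}\times I)$, and for every closed $J\subseteq\mathbb{R}\times\mathbb{S}$, $\pi(R_{s,t(\mathcal{H})}(J))\subseteq R_{s,\mathcal{H}}(\overline{\pi(J)})$.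
   Context: A topological timed transition system (TTTS) is a pair $(\mathbb{S},\to)$ with $\mathbb{S}$ a topological space and $\to\ \subseteq \mathbb{S}\times\mathbb{T}\times\mathbb{S}$ a timed transition relation, written $s\to^d s'$, where $\mathbb{T}=\{d\in\mathbb{R}\mid d\ge 0\}$; the untimed transition relation is $s\to s'$ iff $\exists d.\ s\to^d s'$. $\mathsf{C}(X)$ denotes the set of closed subsets of a topological space $X$, and $\overline{S}$ the closure of $S$ (smallest closed set containing $S$). Evolution and reachability maps: $E_f(I)$ is the smallest $S\subseteq\mathbb{T}\times\mathbb{S}$ with $\{0\}\times I\subseteq S$ and closed under timed transitions ($(t,s)\in S\wedge s\to^d s'\Rightarrow (t+d,s')\in S$); $R_f(I)$ is the smallest $S\subseteq\mathbb{S}$ with $I\subseteq S$ and closed under transitions ($s\in S\wedge s\to s'\Rightarrow s'\in S$). Safe maps: $E_s:\mathsf{C}(\mathbb{S})\to\mathsf{C}(\mathbb{T}\times\mathbb{S})$, $E_s(I)$ = the smallest closed $S\subseteq\mathbb{T}\times\mathbb{S}$ with $\{0\}\times I\subseteq S$ and closed under timed transitions; $R_s:\mathsf{C}(\mathbb{S})\to\mathsf{C}(\mathbb{S})$, $R_s(I)$ = the smallest closed $S\subseteq\mathbb{S}$ with $I\subseteq S$ and closed under transitions. $\pi:\mathbb{R}\times\mathbb{S}\to\mathbb{S}$, $\pi(t,s)=s$, and $\pi(J)$ is the image of $J$. A hybrid system $\mathcal{H}=(F,G)$ on a Banach space $\mathbb{S}$ is a pair of binary relations on $\mathbb{S}$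 (flow and jump). It induces a TTTS where $s\to^d s'$ iff either $d=0$ and $(s,s')\in G$, or $d>0$ and there is a continuous $f:[0,d]\to\mathbb{S}$ with derivative $\dot f$ defined and continuous on $(0,d)$, $f(0)=s$, $f(d)=s'$, and $(f(t),\dot f(t))\in F$ for all $t\in(0,d)$. $E_{s,\mathcal{H}}$, $R_{s,\mathcal{H}}$ denote the safe maps of this induced TTTS. The clocked system $t(\mathcal{H})=(F',G')$ on $\mathbb{R}\times\mathbb{S}$ has $F'=\{((t,s),(1,\dot s))\mid (s,\dot s)\in F\}$ and $G'=\{((t,s),(t,s^+))\mid (s,s^+)\in G\}$. *)

(* Defs.v *)
(* The real numbers are an arbitrary R : realType. *)
From HB Require Import structures.
From mathcomp Require Import all_boot all_order all_algebra.
From mathcomp Require Import all_classical all_reals all_analysis.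

Set Implicit Arguments.
Unset Strict Implicit.
Unset Printing Implicit Defensive.
Import Order.TTheory GRing.Theory Num.Theory.
Import numFieldNormedType.Exports.
Local Open Scope classical_set_scope.
Local Open Scope ring_scope.

(* Used as a type, [time R] is the subtype of nonnegative reals with the
   topology induced by R, so [time R * S] is a product of topological spaces. *)
Definition time (R : realType) : set R := [set d : R | 0 <= d].
Arguments time : clear implicits.

Definition time0 (R : realType) : time R :=
  exist _ (0 : R) (mem_set (lexx 0 : time R 0)).

Lemma time_ge0 (R : realType) (d : time R) : 0 <= val d.
Proof. exact: (set_mem (valP d)). Qed.

Definition time_add (R : realType) (t d : time R) : time R :=
  exist _ (val t + val d)
    (mem_set (addr_ge0 (time_ge0 t) (time_ge0 d) : time R (val t + val d))).

(* [to s d s'] reads s -->^d s'. *)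
Definition timed_relation (R : realType) (S : Type) := S -> time R -> S -> Prop.

Section SafeMaps.
Context (R : realType) (S : topologicalType) (to : timed_relation R S).

Definition untimed (s s' : S) : Prop := exists d : time R, to s d s'.

Definition timed_invariant (A : set (time R * S)) : Prop :=
  forall t s d s', A (t, s) -> to s d s' -> A (time_add t d, s').

Definition untimed_invariant (A : set S) : Prop :=
  forall s s', A s -> untimed s s' -> A s'.

Definition E_f (I : set S) : set (time R * S) :=
  smallest timed_invariant ([set time0 R] `*` I).

Definition R_f (I : set S) : set S := smallest untimed_invariant I.

(* The safe maps are only of interest on closed sets of initial states; that
   they take closed values is proved below. *)
Definition E_s (I : set S) : set (time R * S) :=
  smallest (fun A => closed A /\ timed_invariant A) ([set time0 R] `*` I).

Definition R_s (I : set S) : set S :=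
  smallest (fun A => closed A /\ untimed_invariant A) I.

(* [smallest] is an intersection; it also belongs
   to the family over which it is taken, hence is a minimum. *)
Lemma E_f_invariant I : timed_invariant (E_f I).
Proof.
move=> t s d s' As ss' A [iA IA].
by apply: (iA) ss'; exact: As.
Qed.

Lemma R_f_invariant I : untimed_invariant (R_f I).
Proof.
move=> s s' As ss' A [iA IA].
by apply: (iA) ss'; exact: As.
Qed.

Lemma E_s_closed_invariant I : closed (E_s I) /\ timed_invariant (E_s I).
Proof.
split; first by apply: closed_bigI => A [[]].
move=> t s d s' As ss' A [[cA iA] IA].
by apply: (iA) ss'; exact: As.
Qed.

Lemma R_s_closed_invariant I : closed (R_s I) /\ untimed_invariant (R_s I).
Proof.
split; first by apply: closed_bigI => A [[]].
move=> s s' As ss' A [[cA iA] IA].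
by apply: (iA) ss'; exact: As.
Qed.

End SafeMaps.

(* Properties of a map from the closed sets of X to the closed sets of Y. *)
Definition monotonic_on_closed (X Y : topologicalType) (f : set X -> set Y) : Prop :=
  forall I J, closed I -> closed J -> I `<=` J -> f I `<=` f J.

(* The empty union is included. *)
Definition preserves_finite_closed_unions (X Y : topologicalType)
    (f : set X -> set Y) : Prop :=
  forall F : set (set X), finite_set F -> (forall I, F I -> closed I) ->
    f (\bigcup_(I in F) I) = \bigcup_(I in F) f I.

(* The inclusion of T x S in R x S. *)
Definition time_incl (R : realType) (S : Type) (p : time R * S) : R * S :=
  (val p.1, p.2).
Arguments time_incl {R S} p.

Definition state_proj (R : realType) (S : Type) (p : R * S) : S := p.2.
Arguments state_proj {R S} p.

(* Completeness of the state space plays no role in these definitions, so they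
   are given on any normed space; this lets them apply directly to R * S. *)
Record hybrid_system (R : realType) (V : normedModType R) := HybridSystem {
  flow : set (V * V);
  jump : set (V * V) }.

(* A function on [0, d] is represented by a total function on R; its values
   outside [0, d] are irrelevant, and its derivative is only considered at
   interior points. *)
Definition hybrid_trans (R : realType) (V : normedModType R)
    (H : hybrid_system V) : timed_relation R V :=
  fun s d s' =>
    (val d = 0 /\ jump H (s, s')) \/
    (0 < val d /\ exists f : R -> V,
      [/\ {within `[0, val d], continuous f},
          (forall t, t \in `]0, val d[ -> derivable f t 1) /\
            {within `]0, val d[, continuous (derive1 f)},
          f 0 = s,
          f (val d) = s' &
          forall t, t \in `]0, val d[ -> flow H (f t, derive1 f t)]).

Definition clocked (R : realType) (V : normedModType R)
    (H : hybrid_system V) : hybrid_system (R * V)%type :=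
  @HybridSystem R (R * V)%type
    [set ((t, p.1), (1, p.2)) | t in [set: R] & p in flow H]
    [set ((t, p.1), (t, p.2)) | t in [set: R] & p in jump H].

(* Main.v *)
(* Every inclusion out of a safe map is an instance of minimality. The monotone
   and union properties hold because finite unions of closed invariant sets are
   closed and invariant; the comparisons between maps pull a closed invariant
   set back along a continuous map. For clocked systems, the flows of t(H) from
   (t, s) of duration d are exactly the pairs of the clock x |-> t + x and a
   flow of H from s, so that closed invariant sets correspond through the closed
   embedding of T x S into R x S. *)
Require Import Defs.
From HB Require Import structures.
From mathcomp Require Import all_boot all_order all_algebra.
From mathcomp Require Import all_classical all_reals all_analysis.
Import Order.TTheory GRing.Theory Num.Theory.
Import numFieldNormedType.Exports.
Local Open Scope classical_set_scope.
Local Open Scope ring_scope.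

Lemma smallestS {T : Type} (C : set T -> Prop) {G1 G2 : set T} :
  G1 `<=` G2 -> smallest C G1 `<=` smallest C G2.
Proof. by move=> G12 x G1x A [CA G2A]; apply: G1x; split=> // y /G12 /G2A. Qed.

(** The union on the right contains all generators, so once it satisfies [C], minimality bounds the
    left side by it; the converse is monotonicity in the generators. *)
Lemma smallest_bigcup {T K : Type} (C : set T -> Prop) (F : set K)
    (G : K -> set T) :
  C (\bigcup_(k in F) smallest C (G k)) ->
  smallest C (\bigcup_(k in F) G k) = \bigcup_(k in F) smallest C (G k).
Proof.
move=> CU; apply/seteqP; split.
  apply: smallest_sub => // x [k Fk Gx].
  by exists k => //; exact: sub_gen_smallest.
by apply: bigcup_sub => k Fk; apply: smallestS => x Gx; exists k.
Qed.

Lemma continuous_pair {T U V : topologicalType} (f : T -> U) (g : T -> V) :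
  continuous f -> continuous g -> continuous (fun x => (f x, g x)).
Proof. by move=> cf cg x; apply: cvg_pair; [exact: cf|exact: cg]. Qed.

(** * Order properties of the safe maps *)

Section SafeMapProperties.
Context {R : realType} {S : topologicalType} (to : timed_relation R S).

Lemma E_s_preserves_finite_closed_unions :
  preserves_finite_closed_unions (E_s to).
Proof.
move=> F finF _; rewrite /E_s setX_bigcupr smallest_bigcup//; split.
  (* Finiteness of [F] enters here, for closedness; invariance survives any union, because a
     transition starts inside a single member. *)
  by apply: closed_bigcup => // I _; exact: (E_s_closed_invariant to I).1.
move=> t s d s' [I FI Its] ss'; exists I => //.
exact: (E_s_closed_invariant to I).2 Its ss'.
Qed.

Lemma R_s_preserves_finite_closed_unions :
  preserves_finite_closed_unions (R_s to).
Proof.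
move=> F finF _; rewrite /R_s smallest_bigcup//; split.
  by apply: closed_bigcup => // I _; exact: (R_s_closed_invariant to I).1.
move=> s s' [I FI Is] ss'; exists I => //.
exact: (R_s_closed_invariant to I).2 Is ss'.
Qed.

Lemma R_s_idem (I : set S) : R_s to I = R_s to (R_s to I).
Proof.
apply/seteqP; split; first exact: sub_gen_smallest.
by apply: smallest_sub => //; exact: R_s_closed_invariant.
Qed.

(** The preimage of [R_s to I] under [snd] is closed by continuity, and invariant because forgetting
    the duration of a timed transition gives an untimed one. *)
Lemma state_proj_E_s (I : set S) :
  state_proj @` (time_incl @` E_s to I) `<=` R_s to I.
Proof.
suff EsI : E_s to I `<=` snd @^-1` R_s to I.
  by move=> _ [_ [p Ep <-] <-]; exact: EsI.
have [clR invR] := R_s_closed_invariant to I.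
apply: smallest_sub => [|[t s] [_ Is]]; last exact: sub_gen_smallest.
split; first by apply: preimage_closed => // p _; exact: cvg_snd.
by move=> t s d s' Rs ss'; apply: invR Rs _; exists d.
Qed.

(** The safe set is itself invariant, hence one of the sets intersected in [E_f]. *)
Lemma E_f_sub_E_s (I : set S) : E_f to I `<=` E_s to (closure I).
Proof.
apply: smallest_sub; first exact: (E_s_closed_invariant to _).2.
by apply: sub_smallest => -[t s] [? ?]; split=> //; exact: subset_closure.
Qed.

Lemma R_f_sub_R_s (I : set S) : R_f to I `<=` R_s to (closure I).
Proof.
apply: smallest_sub; first exact: (R_s_closed_invariant to _).2.
by apply: sub_smallest; exact: subset_closure.
Qed.

End SafeMapProperties.

(** * Topology of the inclusion of T x S in R x S *)

Section TimeInclusion.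
Context {R : realType} {S : topologicalType}.

Lemma time_val_continuous : continuous (fun t : time R => val t).
Proof. exact: initial_continuous. Qed.

Lemma time_incl_continuous : continuous (@time_incl R S).
Proof.
apply: (@continuous_pair (time R * S)%type R S (fun p => val p.1) snd) => p;
  last exact: cvg_snd.
by apply: continuous_comp; [exact: cvg_fst|exact: time_val_continuous].
Qed.

Definition time_clip (t : R) : time R :=
  exist _ (`|t|) (mem_set (normr_ge0 t : time R `|t|)).

(** The topology on [time R] is initial for [val], so continuity is tested after composing with
    [val], which leaves the norm. *)
Lemma time_clip_continuous : continuous time_clip.
Proof.
apply: continuous_comp_initial => t; exact: norm_continuous.
Qed.

(* The image is the part over nonnegative times of a preimage under the
   retraction (t, s) |-> (|t|, s). *)
Lemma time_incl_closed (A : set (time R * S)) :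
  closed A -> closed (time_incl @` A).
Proof.
move=> clA.
have -> : time_incl @` A = (fst @^-1` [set t : R | 0 <= t]) `&`
    (fun p : R * S => (time_clip p.1, p.2)) @^-1` A.
  apply/seteqP; split=> [_ [[t s] As <-]|[t s] [/= t0 As]] /=.
    split; first exact: time_ge0.
    rewrite (_ : time_clip _ = t)//; apply: val_inj => /=.
    by rewrite ger0_norm//; exact: time_ge0.
  by exists (time_clip t, s) => //; rewrite /time_incl /= ger0_norm.
apply: closedI; apply: preimage_closed => //.
- by move=> p _; exact: cvg_fst.
- move=> p _; move: p.
  apply: (@continuous_pair (R * S)%type (time R) S (fun p => time_clip p.1) snd)
    => p.
    by apply: continuous_comp; [exact: cvg_fst|exact: time_clip_continuous].
  exact: cvg_snd.
Qed.

End TimeInclusion.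

(** * Derivatives of curves in a product space *)

Section DerivePair.
Context {R : realType} {V W : normedModType R}.

(** Turns derivatives into limits of difference quotients; these are computed componentwise in a
    product, so the lemmas on pairs and projections reduce to convergence in the product
    topology. *)
Lemma is_deriveP {U : normedModType R} (f : R -> U) (t : R) (df : U) :
  is_derive t 1 f df <->
  h^-1 *: (f (h *: 1 + t) - f t) @[h --> 0^'] --> df.
Proof.
split=> [[cf <-]|cf]; first exact: cf.
by apply: DeriveDef; [apply/cvg_ex; exists df|apply/cvg_lim].
Qed.

Lemma is_derive_pair (f : R -> V) (g : R -> W) (t : R) (df : V) (dg : W) :
  is_derive t 1 f df -> is_derive t 1 g dg ->
  is_derive t 1 (fun x => (f x, g x)) (df, dg).
Proof.
by move=> /is_deriveP cf /is_deriveP cg; apply/is_deriveP; exact: cvg_pair.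
Qed.

Lemma is_derive_fst (f : R -> V * W) (t : R) (df : V * W) :
  is_derive t 1 f df -> is_derive t 1 (fst \o f) df.1.
Proof.
move=> /is_deriveP cf; apply/is_deriveP.
by apply: (cvg_comp _ fst cf); exact: cvg_fst.
Qed.

Lemma is_derive_snd (f : R -> V * W) (t : R) (df : V * W) :
  is_derive t 1 f df -> is_derive t 1 (snd \o f) df.2.
Proof.
move=> /is_deriveP cf; apply/is_deriveP.
by apply: (cvg_comp _ snd cf); exact: cvg_snd.
Qed.

Lemma is_derive1 {U : normedModType R} (f : R -> U) (t : R) :
  derivable f t 1 -> is_derive t 1 f (derive1 f t).
Proof. by move=> /derivableP; rewrite derive1E. Qed.

Lemma derive1_val {U : normedModType R} {f : R -> U} {t : R} {df : U} :
  is_derive t 1 f df -> derive1 f t = df.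
Proof. by rewrite derive1E => /(@derive_val _ _ _ _ _ _ _). Qed.

End DerivePair.

(** * Transitions and safe maps of clocked systems *)

Section Clocked.
Context {R : realType} {V : normedModType R} (H : hybrid_system V).

Lemma clocked_trans_lift (t : R) (s : V) (d : time R) (s' : V) :
  hybrid_trans H s d s' ->
  hybrid_trans (clocked H) (t, s) d (t + val d, s').
Proof.
move=> [[d0 ss']|[d0 [f [cf [df cdf] f0 fd flf]]]].
  by left; split=> //; rewrite d0 addr0; exists t => //; exists (s, s').
pose g (x : R) : R * V := (t + x, f x).
have dg x : x \in `]0, val d[ -> is_derive x 1 g (1, derive1 f x).
  move=> xd; apply: is_derive_pair; last exact/is_derive1/df.
  by apply: is_derive_eq; rewrite add0r.
right; split=> //; exists g; split.
- apply: continuous_pair => // x.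
  apply: (@continuous_subspaceT _ _ _ (fun y : R => t + y)) => y.
  by apply: cvgD; [exact: cvg_cst|exact: cvg_id].
- split=> [x /dg[]//|].
  (* The derivative of [g] is known only on the open interval; its continuity there is transferred
     from a function agreeing with it on that interval. *)
  apply: (@subspace_eq_continuous _ _ _ (fun x => (1 : R, derive1 f x))).
    by move=> x /set_mem /dg /derive1_val.
  by apply: continuous_pair => // x; exact: cvg_cst.
- by rewrite /g addr0 f0.
- by rewrite /g fd.
- move=> x xd; rewrite (derive1_val (dg _ xd)).
  by exists (t + x) => //; exists (f x, derive1 f x) => //; exact: flf.
Qed.

(* The clock component of a flow has derivative 1, so the mean value theorem
   determines its final value. *)
Lemma clocked_trans_proj (t : R) (s : V) (d : time R) (t' : R) (s' : V) :
  hybrid_trans (clocked H) (t, s) d (t', s') ->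
  t' = t + val d /\ hybrid_trans H s d s'.
Proof.
move=> [[d0 [u _ [p Gp [? ? ? ?]]]]|[d0 [f [cf [df cdf] f0 fd flf]]]].
  by subst; split; [rewrite d0 addr0|left; split=> //; case: p Gp].
have cmp1 (A : set R) (g : R -> R * V) : {within A, continuous g} ->
    {within A, continuous (fst \o g)}.
  move=> cg x; apply: (@continuous_comp (subspace A) (R * V)%type R g fst).
      exact: cg.
    exact: cvg_fst.
have cmp2 (A : set R) (g : R -> R * V) : {within A, continuous g} ->
    {within A, continuous (snd \o g)}.
  move=> cg x; apply: (@continuous_comp (subspace A) (R * V)%type V g snd).
      exact: cg.
    exact: cvg_snd.
have d2 x : x \in `]0, val d[ -> is_derive x 1 (snd \o f) (derive1 f x).2.
  by move=> /df /is_derive1 /is_derive_snd.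
split.
  have d1 x : x \in `]0, val d[ -> is_derive x 1 (fst \o f) 1.
    move=> xd; have /is_derive1 /is_derive_fst := df _ xd.
    (* The flow relation of [clocked H] forces the first component of the derivative to be [1]. *)
    by have [u _ [p _ [_ <-]]] := flf _ xd.
  have [c _] := MVT d0 d1 (cmp1 _ _ cf).
  by rewrite /= f0 fd mul1r subr0 => /eqP; rewrite subr_eq addrC => /eqP.
right; split=> //; exists (snd \o f); split.
- exact: cmp2.
- split=> [x /d2[]//|].
  apply: (@subspace_eq_continuous _ _ _ (snd \o derive1 f)); last exact: cmp2.
  by move=> x /set_mem /d2 /derive1_val.
- by rewrite /= f0.
- by rewrite /= fd.
- move=> x xd; rewrite (derive1_val (d2 _ xd)) /=.
  by have [u _ [[p q] Fp [<- <-]]] := flf _ xd.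
Qed.

Lemma E_s_clocked (I : set V) :
  time_incl @` E_s (hybrid_trans H) I =
  R_s (hybrid_trans (clocked H)) ([set 0] `*` I).
Proof.
apply/seteqP; split.
  set A := R_s _ _; have [clA invA] : closed A /\ _ := R_s_closed_invariant _ _.
  suff EA : E_s (hybrid_trans H) I `<=` time_incl @^-1` A.
    by move=> _ [p Ep <-]; exact: EA.
  apply: smallest_sub => [|[_ s] [/= -> Is]]; last exact: sub_gen_smallest.
  split; first by apply: preimage_closed => // p _; exact: time_incl_continuous.
  move=> t s d s' As ss'; apply: invA As _; exists d.
  exact: clocked_trans_lift.
have [clE invE] := E_s_closed_invariant (hybrid_trans H) I.
apply: smallest_sub; first split.
- exact: time_incl_closed.
- move=> _ [t' s'] [[t s] Ets <-] [d /clocked_trans_proj[-> ss']].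
  (* The arrival time is forced to be [val t + val d], so the transition stays in the image of
     [time_incl]. *)
  by exists (time_add t d, s') => //; exact: invE Ets ss'.
- move=> [_ s] [/= -> Is]; exists (time0 R, s) => //.
  exact: sub_gen_smallest.
Qed.

(** Forgetting the clock maps transitions of [clocked H] to transitions of [H] from any clock value,
    even a negative one, so [snd] pulls closed invariant sets back to closed invariant sets. *)
Lemma state_proj_R_s_clocked (J : set (R * V)) :
  state_proj @` R_s (hybrid_trans (clocked H)) J `<=`
  R_s (hybrid_trans H) (closure (state_proj @` J)).
Proof.
set A := R_s (hybrid_trans H) _.
have [clA invA] : closed A /\ _ := R_s_closed_invariant _ _.
suff RA : R_s (hybrid_trans (clocked H)) J `<=` snd @^-1` A.
  by move=> _ [p Rp <-]; exact: RA.
apply: smallest_sub => [|p Jp]; last first.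
  by apply: sub_gen_smallest; apply: subset_closure; exists p.
split; first by apply: preimage_closed => // p _; exact: cvg_snd.
move=> [t s] [t' s'] As [d /clocked_trans_proj[_ ss']].
by apply: invA As _; exists d.
Qed.

End Clocked.

Theorem theorem2 (R : realType) :
  (forall (S : topologicalType) (to : timed_relation R S),
    [/\ monotonic_on_closed (E_s to) /\ preserves_finite_closed_unions (E_s to),
        [/\ monotonic_on_closed (R_s to),
            preserves_finite_closed_unions (R_s to),
            (forall I : set S, closed I ->
               I `<=` R_s to I /\ R_s to I = R_s to (R_s to I)) &
            (forall I : set S, closed I ->
               state_proj @` (time_incl @` E_s to I) `<=` R_s to I)] &
        forall I : set S,
          E_f to I `<=` E_s to (closure I) /\
          R_f to I `<=` R_s to (closure I)])
  /\
  (forall (S : completeNormedModType R) (H : hybrid_system S),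
    (forall I : set S, closed I ->
       time_incl @` E_s (hybrid_trans H) I =
       R_s (hybrid_trans (clocked H)) ([set 0] `*` I)) /\
    (forall J : set (R * S), closed J ->
       state_proj @` R_s (hybrid_trans (clocked H)) J `<=`
       R_s (hybrid_trans H) (closure (state_proj @` J)))).
Proof.
split=> [S to|S H].
  split.
  - split; last exact: E_s_preserves_finite_closed_unions.
    by move=> I J _ _ IJ; apply: smallestS => p [p0 /IJ].
  - split.
    + by move=> I J _ _; exact: smallestS.
    + exact: R_s_preserves_finite_closed_unions.
    + by move=> I _; split; [exact: sub_gen_smallest|exact: R_s_idem].
    + by move=> I _; exact: state_proj_E_s.
  - by move=> I; split; [exact: E_f_sub_E_s|exact: R_f_sub_R_s].
by split=> [I _|J _]; [exact: E_s_clocked|exact: state_proj_R_s_clocked].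
Qed.
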